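(* Let $\Gamma$ be a finitely generated residually finite group. If the finite-index normal subgroup membership problem in $\Gamma$ is solvable and the word problem for $\Gamma$ is solvable, then for every finite generating set $X$ of $\Gamma$ the residual finiteness growth function $\mathrm{F}_{\Gamma, X} : \mathbb{N} \to \mathbb{N}$ is computable.
   Context: Here $\mathbb{N} = \{1,2,3,\ldots\}$. Let $\Gamma$ be a residually finite group generated by a finite set $X$. An element $\gamma \in \Gamma$ is detected by a finite quotient $Q$ of $\Gamma$ if there is a surjective homomorphism $\phi : \Gamma \to Q$ with $\gamma \notin \ker \phi$. The residual finiteness growth function $\mathrm{F}_{\Gamma, X} : \mathbb{N} \to \mathbb{N}$ is defined by letting $\mathrm{F}_{\Gamma,X}(n)$ be the minimal natural number $N$ such that every nontrivial element of $\Gamma$ of word length $\leq n$ with respect to $X$ (that is, expressible as a product of at most $n$ elements of $X \cup X^{-1}$) is detected by some finite quotient $Q$ of $\Gamma$ (which may depend on the element) of cardinality $\leq N$. A function $\mathbb{N} \to \mathbb{N}$ is computable if it is computed by an algorithm (Turing machine), i.e. is a total recursive function. For a finitely generated group $G$, the finite-index normal subgroup membership problem in $G$ is solvable if there is an algorithm which, for every element $g \in G$ and every finite-index normal subgroup $H \lhd G$, determines in a finite amount of time whether $g \in H$. Here elements of $G$ are given as words in a fixed finite generating set of $G$ and its inverses, and $H$ is given by a finite list of words whose images in $G$ generate $H$ (finite-index subgroups of finitely generated groups are finitely generated); nothing is required of the algorithm on lists that do not generate a finite-index normal subgroup. The word problem for $G$ is solvable if there is an algorithm deciding whether a given word in a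 finite generating set and its inverses represents the identity of $G$. *)

(* Defs.v *)
From mathcomp Require Import all_boot all_fingroup.
From mathcomp Require Import boolp classical_sets functions cardinality.

Set Implicit Arguments.
Unset Strict Implicit.
Unset Printing Implicit Defensive.

Local Open Scope classical_set_scope.
Local Open Scope nat_scope.

(* [recfun n] is the type of programs for n-ary partial recursive functions,
   and [computes f v y] means that f, run on input v, halts with output y.
   - [Rcomp f g] is f(g_0(v), ..., g_(m-1)(v));
   - [Rprec f g] is the function h given by h(0, v) = f(v) and
     h(i + 1, v) = g(i, h(i, v), v);
   - [Rmu f] is the unbounded search for the least y such that f(y, v) = 0,
     which diverges if f(i, v) diverges for some i met by the search. *)
Inductive recfun : nat -> Type :=
| Rzero n : recfun n
| Rsucc : recfun 1
| Rproj n (i : 'I_n) : recfun n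
| Rcomp m n (f : recfun m) (g : 'I_m -> recfun n) : recfun n
| Rprec n (f : recfun n) (g : recfun n.+2) : recfun n.+1
| Rmu n (f : recfun n.+1) : recfun n.

Fixpoint computes n (f : recfun n) : n.-tuple nat -> nat -> Prop :=
  match f in recfun n return n.-tuple nat -> nat -> Prop with
  | Rzero _ => fun _ y => y = 0
  | Rsucc => fun v y => y = (thead v).+1
  | Rproj _ i => fun v y => y = tnth v i
  | Rcomp m _ f g => fun v y =>
      exists w : m.-tuple nat,
        (forall i, computes (g i) v (tnth w i)) /\ computes f w y
  | Rprec n f g => fun v y =>
      let u : n.-tuple nat := [tuple of behead v] in
      exists h : nat -> nat,
        [/\ computes f u (h 0),
            forall i, i < thead v ->
              computes g [tuple of i :: h i :: u] (h i.+1)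
          & y = h (thead v)]
  | Rmu _ f => fun v y =>
      computes f [tuple of y :: v] 0 /\
      forall i, i < y -> exists z, computes f [tuple of i :: v] z.+1
  end.

Lemma computes_functional n (f : recfun n) v y z :
  computes f v y -> computes f v z -> y = z.
Proof.
elim: f v y z => {n} /=.
- by move=> n v y z -> ->.
- by move=> v y z -> ->.
- by move=> n i v y z -> ->.
- move=> m n f IHf g IHg v y z [w [gw fw]] [w' [gw' fw']].
  suff ww' : w = w' by rewrite -ww' in fw'; apply: IHf fw fw'.
  by apply: eq_from_tnth => i; apply: IHg (gw i) (gw' i).
- move=> n f IHf g IHg v y z [h [h0 hS ->]] [h' [h'0 h'S ->]].
  have: thead v <= thead v by [].
  elim: {1 3 4}(thead v) => [_|k IHk ltk]; first exact: IHf h0 h'0.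
  have hk := IHk (ltnW ltk).
  by have := hS _ ltk; rewrite hk => /IHg; apply; apply: h'S.
- move=> n f IHf v y z [fy ly] [fz lz].
  case: (ltngtP y z) => // [yz|zy].
    by have [x fx] := lz _ yz; have := IHf _ _ _ fy fx.
  by have [x fx] := ly _ zy; have := IHf _ _ _ fz fx.
Qed.

Definition posnat := {n : nat | 0 < n}.

Definition posnat1 : posnat := exist _ 1 isT.

Definition computable (F : posnat -> posnat) : Prop :=
  exists f : recfun 1, forall n : posnat,
    computes f [tuple of [:: val n]] (val (F n)).

Section Group.
Variable G : groupType.
Implicit Types (X S : seq G) (g : G) (n N : nat).
Local Open Scope group_scope.

Definition length_le X n : set G :=
  [set g | exists s : seq G,
     [/\ (size s <= n)%N,
         {in s, forall x, (x \in X) || (x^-1 \in X)}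
       & g = \prod_(x <- s) x]].

Definition generated X : set G := [set g | exists n, length_le X n g].

Definition generates X : Prop := generated X = setT.

Definition finitely_generated : Prop := exists X, generates X.

(* The letter (b, i) stands for the i-th entry of S if b is false, and for its
   inverse if b is true. *)
Definition word S := seq (bool * 'I_(size S)).

Definition letter_val S (l : bool * 'I_(size S)) : G :=
  let x := tnth (in_tuple S) l.2 in if l.1 then x^-1 else x.

Definition word_val S (w : word S) : G := \prod_(l <- w) letter_val l.

(* Words and lists of words are presented to programs through the bijection
   [CodeSeq.code : seq nat -> nat]. *)
Definition word_code S (w : word S) : nat :=
  CodeSeq.code [seq (l.1 + l.2.*2)%N | l : bool * 'I_(size S) <- w].

Definition words_code S (L : seq (word S)) : nat :=
  CodeSeq.code [seq word_code w | w <- L].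

Definition finite_index (H : set G) : Prop :=
  finite_set (range (fun g => [set g * h | h in H])).

Definition normal_set (H : set G) : Prop :=
  forall h g, H h -> H (h ^ g).

Definition word_problem_solvable : Prop :=
  exists S, generates S /\
    exists f : recfun 1, forall w : word S,
      computes f [tuple of [:: word_code w]] (word_val w == 1).

(* The output is 1 for membership and 0 for non-membership; the behaviour of
   the program f is unconstrained (it may diverge) on lists of words that do
   not generate a finite-index normal subgroup. *)
Definition finite_index_normal_membership_solvable : Prop :=
  exists S, generates S /\
    exists f : recfun 2, forall (w : word S) (L : seq (word S)),
      let H := generated [seq word_val u | u <- L] in
      finite_index H -> normal_set H ->
      computes f [tuple of [:: word_code w; words_code L]] `[< H (word_val w) >].

Definition detected_by g (Q : finGroupType) : Prop :=
  exists phi : {multiplicative G -> Q},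
    (forall q, exists x, phi x = q) /\ phi g <> 1.

Definition residually_finite : Prop :=
  forall g, g <> 1 -> exists Q, detected_by g Q.

Definition detects_ball X n N : Prop :=
  forall g, length_le X n g -> g <> 1 ->
    exists Q : finGroupType, detected_by g Q /\ (#|Q| <= N)%N.

Definition is_rf_growth X (n N : posnat) : Prop :=
  detects_ball X (val n) (val N) /\
  forall M : posnat, detects_ball X (val n) (val M) -> (val N <= val M)%N.

(* The default value [posnat1] is never used when G is residually finite: see
   [rf_growthP]. *)
Definition rf_growth X (n : posnat) : posnat :=
  xget posnat1 [set N | is_rf_growth X n N].

Lemma rf_growthP X (n : posnat) : residually_finite -> is_rf_growth X n (rf_growth X n).
Proof.
move=> rfG; apply: xgetPex.
have [N0 N0P] : exists N0, detects_ball X (val n) N0.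
  pose V (s : (val n).-bseq 'I_(size (X ++ [seq x^-1 | x <- X]))) : G :=
    \prod_(i <- s) tnth (in_tuple (X ++ [seq x^-1 | x <- X])) i.
  have /choice[c cP] s : exists N, V s <> 1 ->
      exists Q : finGroupType, detected_by (V s) Q /\ (#|Q| <= N)%N.
    have [->|/eqP/rfG[Q Qs]] := eqVneq (V s) 1; first by exists 0.
    by exists #|Q| => _; exists Q.
  exists (\max_s c s)%N => g [s [ns sX gE]] g1.
  have [t tE] : exists t, s = map (tnth (in_tuple (X ++ [seq x^-1 | x <- X]))) t.
    elim: s sX {ns gE} => [|x s IHs] sX; first by exists [::].
    have /IHs[t ->] : {in s, forall x, (x \in X) || (x^-1 \in X)}.
      by move=> y ys; apply: sX; rewrite inE ys orbT.
    have /tnthP[i ->] : x \in in_tuple (X ++ [seq x^-1 | x <- X]).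
      rewrite mem_cat; have := sX x (mem_head _ _).
      case/orP=> [->//|xX]; apply/orP; right.
      by apply/mapP; exists x^-1; rewrite ?invgK.
    by exists (i :: t).
  have nt : (size t <= val n)%N by rewrite tE size_map in ns.
  have Vt : V (Bseq nt) = g by rewrite gE tE big_map.
  have := cP (Bseq nt); rewrite Vt => /(_ g1)[Q [Qg leQ]].
  by exists Q; split=> //; apply: leq_trans leQ (leq_bigmax _).
have exN : exists N, `[< (0 < N)%N /\ detects_ball X (val n) N >].
  exists N0.+1; apply/asboolP; split=> // g gX g1.
  by have [Q [Qg leQ]] := N0P g gX g1; exists Q; split=> //; apply: leqW.
case: (ex_minnP exN) => N /asboolP[N_gt0 NP] minN.
exists (exist _ N N_gt0); split=> // M MP; apply: minN.
by apply/asboolP; split=> //; apply: (valP M).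
Qed.

End Group.

(* Main.v *)
(* Write K = 2|X| + 1. An element of the ball of radius n is the value of the n
   base-K digits of some i < K^n, where the digit 0 stands for the identity and
   the digits d and K - d for a generator and its inverse. A number t encodes a
   table by which these letters act on the points 0, ..., N - 1. If t passes the
   finite test [regular_table], it is an action of the free group on X in which
   every word fixing 0 acts trivially, so the stabilizer of 0 is a normal
   subgroup of the free group of index at most N; by Schreier's lemma it is
   generated by its words of length 2N. Its image in G is therefore a normal
   subgroup of index at most N with an explicit finite list of generators, for
   which the membership algorithm may be called, and every normal subgroup of
   index at most N arises in this way. Hence it is decidable, uniformly in n and
   N, whether the quotients of order at most N detect the ball of radius n: the
   word problem tells which elements are nontrivial, and there are finitely many
   tables to try. Then F(n) is found by unbounded search on N. *)

From HB Require Import structures.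
Require Import Defs.
From mathcomp Require Import all_boot all_fingroup.
From mathcomp Require Import boolp classical_sets functions cardinality.

Set Implicit Arguments.
Unset Strict Implicit.
Unset Printing Implicit Defensive.

Local Open Scope nat_scope.

Local Notation generated := Defs.generated.

(** * Closure properties of recursive functions *)

(** A program with [n] inputs is specified by an expression in an environment of de Bruijn
    variables, variable 0 being bound last, so that most closure properties can be stated without
    tuples. *)
Definition recursive n (e : (nat -> nat) -> nat) : Prop :=
  exists f : recfun n, forall v : n.-tuple nat, computes f v (e (nth 0 v)).

Lemma computes_val n (f : recfun n) (v w : n.-tuple nat) y :
  tval v = tval w -> computes f v y -> computes f w y.
Proof. by move=> /val_inj->. Qed.

Section Recursive.
Implicit Types (r : nat -> nat) (a b c : (nat -> nat) -> nat).
Implicit Types (P Q : (nat -> nat) -> bool).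

Lemma recursive_ext n a b : a =1 b -> recursive n a -> recursive n b.
Proof. by move=> ab [f fP]; exists f => v; rewrite -ab. Qed.

Lemma recursive_var n i : i < n -> recursive n (fun r => r i).
Proof.
move=> lti; exists (Rproj (Ordinal lti)) => v /=.
by rewrite (tnth_nth 0).
Qed.

Lemma recursive_oracle n (f : recfun 1) a b :
    (forall r, computes f [tuple of [:: a r]] (b r)) ->
  recursive n a -> recursive n b.
Proof.
move=> fP [g gP]; exists (Rcomp f (fun=> g)) => v /=.
exists [tuple of [:: a (nth 0 v)]]; split=> // i.
by rewrite ord1; apply: gP.
Qed.

Lemma recursive_succ n a : recursive n a -> recursive n (fun r => (a r).+1).
Proof. exact: (@recursive_oracle _ Rsucc). Qed.

Lemma recursive_const n k : recursive n (fun=> k).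
Proof. by elim: k => [|k /recursive_succ//]; exists (Rzero n). Qed.

(* The step only has to halt below the bound: a loop whose bound is a boolean is
   a conditional that may call a partial program. *)
Lemma recursive_rec_partial n a b (s : nat -> nat -> (nat -> nat) -> nat)
    (f : recfun n.+2) :
    recursive n b -> recursive n a ->
    (forall v : n.-tuple nat, forall i, i < b (nth 0 v) -> forall h,
      computes f [tuple of i :: h :: v] (s i h (nth 0 v))) ->
  recursive n (fun r => nat_rect (fun=> nat) (a r) (fun i h => s i h r) (b r)).
Proof.
move=> [pb bP] [pa aP] fP.
pose g (i : 'I_n.+1) := if unlift ord0 i is Some j then Rproj j else pb.
exists (Rcomp (Rprec pa f) g) => v.
exists [tuple of b (nth 0 v) :: v]; split=> [i|] /=.
  rewrite /g; case: unliftP => [j|] -> /=; last exact: bP.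
  by rewrite (tnth_nth 0) /= (tnth_nth 0).
exists (nat_rect (fun=> nat) (a (nth 0 v)) (fun i h => s i h (nth 0 v))).
by split=> //= [|i ltib];
  [apply: computes_val (aP v) | apply: computes_val (fP v i ltib _)].
Qed.

Lemma recursive_rec n a b (s : nat -> nat -> (nat -> nat) -> nat) :
    recursive n a -> recursive n b ->
    recursive n.+2 (fun r => s (r 0) (r 1) (fun j => r j.+2)) ->
  recursive n (fun r => nat_rect (fun=> nat) (a r) (fun i h => s i h r) (b r)).
Proof.
move=> aR bR [f fP]; apply: recursive_rec_partial bR aR _ => v i _ h.
exact: fP.
Qed.

(** The loop runs [c r] times and each pass overwrites the accumulator by [e r], so [f] is never
    called when [c r] is 0. A program that halts only under a promise thus becomes total once the
    promise is decidable. *)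
Lemma recursive_guarded_oracle n (f : recfun 2) a b c e :
    recursive n a -> recursive n b -> recursive n c ->
    (forall r, 0 < c r -> computes f [tuple of [:: a r; b r]] (e r)) ->
  recursive n (fun r => if 0 < c r then e r else 0).
Proof.
move=> [pa aP] [pb bP] cR fP.
pose h := Rcomp f (fun i : 'I_2 => if i == ord0 then pa else pb).
pose g (i : 'I_n) := Rproj (lift ord0 (lift ord0 i)).
apply: recursive_ext (recursive_rec_partial (f := Rcomp h g)
  (s := fun _ _ r => e r) cR (recursive_const n 0) _) => [r|v i lti k].
  by case: (c r).
exists v; split=> [j|].
  by rewrite /g /= (tnth_nth 0) /= (tnth_nth 0).
exists [tuple of [:: a (nth 0 v); b (nth 0 v)]]; split=> [j|].
  by case: j => [[|[|//]] ltj] /=; rewrite (tnth_nth 0); [apply: aP | apply: bP].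
by apply: fP; apply: leq_ltn_trans lti.
Qed.

Lemma recursive_weaken n a :
  recursive n a -> recursive n.+1 (fun r => a (fun j => r j.+1)).
Proof.
move=> [f fP]; exists (Rcomp f (fun i => Rproj (lift ord0 i))) => v.
exists [tuple of behead v]; split=> [j|] /=.
  by rewrite !(tnth_nth 0) /= nth_behead.
suff -> : (fun j => nth 0 v j.+1) = nth 0 (behead v).
  exact: (fP [tuple of behead v]).
by apply/funext => j; rewrite nth_behead.
Qed.

Lemma recursive_add n a b :
  recursive n a -> recursive n b -> recursive n (fun r => a r + b r).
Proof.
move=> aR bR.
apply: recursive_ext (recursive_rec (s := fun _ h _ => h.+1) aR bR _) => [r|].
  by elim: (b r) => [|i /= ->]; rewrite ?addn0 ?addnS.
by apply: recursive_succ; apply: recursive_var.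
Qed.

Lemma recursive_pred n a : recursive n a -> recursive n (fun r => (a r).-1).
Proof.
move=> aR; apply: recursive_ext (recursive_rec (s := fun i _ _ => i)
  (recursive_const n 0) aR _) => [r|]; first by case: (a r).
exact: recursive_var.
Qed.

End Recursive.

Ltac recursive_hyp :=
  match goal with
  | H : recursive _ _ |- _ =>
      first [ exact H | exact (recursive_weaken H)
            | exact (recursive_weaken (recursive_weaken H))
            | exact (recursive_weaken (recursive_weaken (recursive_weaken H)))]
  end.

Ltac recursive_base :=
  repeat first [ by apply: recursive_var | exact: recursive_const | recursive_hyp
    | apply: recursive_succ | apply: recursive_pred | apply: recursive_add ].

Section RecursiveArithmetic.
Implicit Types (r : nat -> nat) (a b c : (nat -> nat) -> nat).
Implicit Types (P Q : (nat -> nat) -> bool).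

Lemma recursive_sub n a b :
  recursive n a -> recursive n b -> recursive n (fun r => a r - b r).
Proof.
move=> aR bR.
apply: recursive_ext (recursive_rec (s := fun _ h _ => h.-1) aR bR _) => [r|].
  by elim: (b r) => [|i /= ->]; rewrite ?subn0 ?subnS.
by recursive_base.
Qed.

Lemma recursive_mul n a b :
  recursive n a -> recursive n b -> recursive n (fun r => a r * b r).
Proof.
move=> aR bR.
apply: recursive_ext (recursive_rec (s := fun _ h r => a r + h)
  (recursive_const n 0) bR _) => [r|].
  by elim: (b r) => [|i /= ->]; rewrite ?muln0 ?mulnS.
by recursive_base.
Qed.

Lemma recursive_exp n a b :
  recursive n a -> recursive n b -> recursive n (fun r => a r ^ b r).
Proof.
move=> aR bR.
apply: recursive_ext (recursive_rec (s := fun _ h r => a r * h)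
  (recursive_const n 1) bR _) => [r|].
  by elim: (b r) => [|i /= ->]; rewrite ?expn0 ?expnS.
by apply: recursive_mul; recursive_base.
Qed.

Lemma recursive_double n a : recursive n a -> recursive n (fun r => (a r).*2).
Proof.
by move=> aR; apply: recursive_ext (recursive_add aR aR) => r; rewrite addnn.
Qed.

Lemma recursive_leq n a b :
  recursive n a -> recursive n b -> recursive n (fun r => a r <= b r).
Proof.
move=> aR bR; apply: recursive_ext
  (recursive_sub (recursive_const n 1) (recursive_sub aR bR)) => r.
by rewrite -subn_eq0; case: (a r - b r).
Qed.

Lemma recursive_and n P Q :
  recursive n P -> recursive n Q -> recursive n (fun r => P r && Q r).
Proof.
by move=> PR QR; apply: recursive_ext (recursive_mul PR QR) => r; rewrite mulnb.
Qed.

Lemma recursive_neg n P : recursive n P -> recursive n (fun r => ~~ P r).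
Proof.
move=> PR; apply: recursive_ext (recursive_sub (recursive_const n 1) PR) => r.
by case: (P r).
Qed.

Lemma recursive_or n P Q :
  recursive n P -> recursive n Q -> recursive n (fun r => P r || Q r).
Proof.
move=> PR QR; apply: recursive_ext
  (recursive_neg (recursive_and (recursive_neg PR) (recursive_neg QR))) => r.
by rewrite negb_and !negbK.
Qed.

Lemma recursive_imp n P Q :
  recursive n P -> recursive n Q -> recursive n (fun r => P r ==> Q r).
Proof.
move=> PR QR; apply: recursive_ext (recursive_or (recursive_neg PR) QR) => r.
by rewrite implybE.
Qed.

Lemma recursive_eq n a b :
  recursive n a -> recursive n b -> recursive n (fun r => a r == b r).
Proof.
move=> aR bR; apply: recursive_ext
  (recursive_and (recursive_leq aR bR) (recursive_leq bR aR)) => r.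
by rewrite eqn_leq.
Qed.

Lemma recursive_if n P a b :
    recursive n P -> recursive n a -> recursive n b ->
  recursive n (fun r => if P r then a r else b r).
Proof.
move=> PR aR bR; apply: recursive_ext (recursive_add (recursive_mul PR aR)
  (recursive_mul (recursive_neg PR) bR)) => r.
by case: (P r); rewrite /= ?mul1n ?mul0n ?addn0.
Qed.

Lemma recursive_mod n a b :
  recursive n a -> recursive n b -> recursive n (fun r => a r %% b r).
Proof.
move=> aR bR; apply: recursive_ext (recursive_rec
  (s := fun _ h r => if h.+1 == b r then 0 else h.+1)
  (recursive_const n 0) aR _) => [r|].
  elim: (a r) => [|i /= ->]; first by rewrite mod0n.
  have [->|b_gt0] := posnP (b r); first by rewrite !modn0.
  have -> : i.+1 %% b r = (i %% b r).+1 %% b r by rewrite -addn1 -modnDml addn1.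
  case: eqP => [->|/eqP neq]; first by rewrite modnn.
  by rewrite [RHS]modn_small // ltn_neqAle neq ltn_mod.
by apply: recursive_if; [apply: recursive_eq | |]; recursive_base.
Qed.

Lemma recursive_div n a b :
  recursive n a -> recursive n b -> recursive n (fun r => a r %/ b r).
Proof.
move=> aR bR; apply: recursive_ext (recursive_rec
  (s := fun i h r => (i.+1 %% b r == 0) + h)
  (recursive_const n 0) aR _) => [r|].
  elim: (a r) => [|i /= ->]; first by rewrite div0n.
  have [->|b_gt0] := posnP (b r); first by rewrite !divn0.
  by rewrite divnS.
apply: recursive_add; last by recursive_base.
apply: recursive_eq; last exact: recursive_const.
by apply: recursive_mod; recursive_base.
Qed.

Lemma recursive_all n b (P : nat -> (nat -> nat) -> bool) :
    recursive n b -> recursive n.+1 (fun r => P (r 0) (fun j => r j.+1)) ->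
  recursive n (fun r => all (fun i => P i r) (iota 0 (b r))).
Proof.
move=> bR PR.
apply: recursive_ext (recursive_rec (s := fun i h r => P i r * h)
  (recursive_const n 1) bR _) => [r|].
  elim: (b r) => [//|i IHi]; rewrite -[in RHS](addn1 i) iotaD all_cat add0n /=.
  by rewrite IHi andbT mulnb andbC.
apply: recursive_mul; last by recursive_base.
case: PR => f fP.
(* The body of the quantifier sees the index and the environment, while a recursion step also
   receives the accumulator as variable 1; these projections skip it. *)
pose g (j : 'I_n.+1) : recfun n.+2 :=
  if unlift ord0 j is Some j' then Rproj (lift ord0 (lift ord0 j'))
  else Rproj ord0.
exists (Rcomp f g) => v; exists [tuple of tnth v ord0 :: behead (behead v)].
split=> [j|].
  rewrite /g; case: unliftP => [j'|] -> //=.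
  by rewrite !(tnth_nth 0) /= !nth_behead.
have := fP [tuple of tnth v ord0 :: behead (behead v)].
rewrite /= (tnth_nth 0); congr (computes _ _ (P _ _)).
by apply/funext => j; rewrite !nth_behead.
Qed.

Lemma recursive_has n b (P : nat -> (nat -> nat) -> bool) :
    recursive n b -> recursive n.+1 (fun r => P (r 0) (fun j => r j.+1)) ->
  recursive n (fun r => has (fun i => P i r) (iota 0 (b r))).
Proof.
move=> bR PR; apply: recursive_ext (recursive_neg
  (recursive_all (P := fun i r => ~~ P i r) bR (recursive_neg PR))) => r.
by rewrite -has_predC; congr (nat_of_bool _); apply: eq_has => i /=; rewrite negbK.
Qed.

Lemma recursive_min n a : recursive n.+1 a ->
  exists f : recfun n, forall (v : n.-tuple nat) y,
    a (nth 0 (y :: v)) = 0 -> (forall i, i < y -> 0 < a (nth 0 (i :: v))) ->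
  computes f v y.
Proof.
move=> [f fP]; exists (Rmu f) => v y ay min_y; split.
  by rewrite -ay; apply: (fP [tuple of y :: v]).
move=> i /min_y/prednK ai; exists (a (nth 0 (i :: v))).-1.
by rewrite ai; apply: (fP [tuple of i :: v]).
Qed.

End RecursiveArithmetic.

(** * Quotients by normal subgroups of finite index *)

Section Quotient.
Variables (G : groupType) (H : set G) (N : nat) (rep : 'I_N -> G).
Local Open Scope group_scope.
Hypotheses (HM : forall x y, H x -> H y -> H (x * y))
  (HV : forall x, H x -> H x^-1) (HJ : normal_set H)
  (repP : forall g, exists i, H ((rep i)^-1 * g)).

(** The representatives may repeat cosets. Keeping one chosen index per coset leaves at most [N] of
    them, and the product of [G] is transported to these indices. *)
Lemma finite_quotient : exists (Q : finGroupType) (phi : {multiplicative G -> Q}),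
  [/\ forall q, exists x, phi x = q, forall g, phi g = 1 <-> H g & (#|Q| <= N)%N].
Proof.
have exR g : exists i, `[< H ((rep i)^-1 * g) >].
  by have [i] := repP g; exists i; apply/asboolP.
pose cls g := xchoose (exR g).
have clsP g : H ((rep (cls g))^-1 * g) by apply/asboolP; apply: (xchooseP (exR g)).
have clsE g g' : cls g = cls g' <-> H (g^-1 * g').
  split=> [E|Hgg'].
    have := HM (HV (clsP g)) (clsP g').
    by rewrite E invgM invgK -mulgA mulVKg.
  (* The choice depends only on the extension of the predicate, which is the same for two elements
     of one coset. *)
  apply: eq_xchoose => i; apply/asboolP/asboolP => Hi.
    by have := HM Hi Hgg'; rewrite -mulgA mulVKg.
  by have := HM Hi (HV Hgg'); rewrite invgM invgK -mulgA mulVKg.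
have clsK g : cls (rep (cls g)) == cls g by apply/eqP/clsE.
pose QT := {i : 'I_N | cls (rep i) == i}.
pose pi g : QT := exist _ (cls g) (clsK g).
pose rp (x : QT) := rep (val x).
have piE g g' : pi g = pi g' <-> H (g^-1 * g').
  rewrite -clsE; split=> [/(congr1 val)//|E]; exact: val_inj.
have piK x : pi (rp x) = x by apply: val_inj; apply/eqP; exact: (valP x).
have rpK g : H (g^-1 * rp (pi g)) by apply/piE; rewrite piK.
pose mul x y := pi (rp x * rp y).
have piM g g' : mul (pi g) (pi g') = pi (g * g').
  apply/esym/piE; rewrite invgM -mulgA.
  (* Normality enters here: the product of the two representatives differs from [g * g'] by a
     conjugate of an element of [H] and another element of [H]. *)
  have := HM (rpK g') (HJ (rp (pi g')) (rpK g)).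
  by rewrite conjgE !mulgA mulgK.
have mulA : associative mul.
  by move=> x y z; rewrite -[x]piK -[y]piK -[z]piK !piM mulgA.
have mul1 : left_id (pi 1) mul by move=> x; rewrite -[x]piK !piM mul1g.
have mulV : left_inverse (pi 1) (fun x => pi (rp x)^-1) mul.
  by move=> x; rewrite -{2}[x]piK !piM mulVg.
pose Q : finGroupType := HB.pack QT (Finite_isGroup.Build QT mulA mul1 mulV).
pose phi : {multiplicative G -> Q} :=
  HB.pack (pi : G -> Q) (isMultiplicative.Build G Q pi (fun x y => esym (piM x y))).
exists Q, phi; split=> [q|g|].
- by exists (rp q); apply: piK.
- by split=> [/esym/piE|Hg]; [|apply/esym/piE]; rewrite invg1 mul1g.
- by rewrite card_sig -[leqRHS]card_ord max_card.
Qed.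

End Quotient.

(** * Subgroups generated by a list *)

Section Generated.
Variables (G : groupType) (Y : seq G).
Implicit Types (x y g : G) (A : set G).
Local Open Scope group_scope.

Lemma generatedM x y : generated Y x -> generated Y y -> generated Y (x * y).
Proof.
move=> [m [s [_ sY ->]]] [k [s' [_ s'Y ->]]]; exists (size (s ++ s')), (s ++ s').
split=> // [z|]; last by rewrite big_cat.
by rewrite mem_cat => /orP[/sY|/s'Y].
Qed.

Lemma generatedV x : generated Y x -> generated Y x^-1.
Proof.
move=> [m [s [_ sY ->]]]; exists (size s), (rev [seq z^-1 | z <- s]).
split; first by rewrite size_rev size_map.
  by move=> z; rewrite mem_rev => /mapP[z' /sY Yz' ->]; rewrite invgK orbC.
elim: s {sY} => [|z s IHs]; first by rewrite !big_nil invg1.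
by rewrite big_cons invgM /= rev_cons -cats1 big_cat IHs big_seq1.
Qed.

Lemma mem_generated x : x \in Y -> generated Y x.
Proof.
move=> Yx; exists 1%N, [:: x]; split=> // [y|]; last by rewrite big_seq1.
by rewrite mem_seq1 => /eqP->; rewrite Yx.
Qed.

Lemma generated_ind A :
    A 1 -> (forall x y, A x -> A y -> A (x * y)) -> (forall x, A x -> A x^-1) ->
    (forall x, x \in Y -> A x) ->
  forall g, generated Y g -> A g.
Proof.
move=> A1 AM AV AY _ [m [s [_ sY ->]]].
elim: s sY => [|x s IHs] sY; first by rewrite big_nil.
rewrite big_cons; apply: AM.
  case/orP: (sY _ (mem_head _ _)) => [/AY//|/AY/AV]; by rewrite invgK.
by apply: IHs => y ys; apply: sY; rewrite inE ys orbT.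
Qed.

End Generated.

(** * Digit expansions and tables *)

Fixpoint digits b m i : seq nat :=
  if m is m'.+1 then (i %/ b ^ m' %% b) :: digits b m' i else [::].

Lemma size_digits b m i : size (digits b m i) = m.
Proof. by elim: m => //= m ->. Qed.

Lemma digits_lt b m i : 0 < b -> all (gtn b) (digits b m i).
Proof. by move=> b_gt0; elim: m => //= m ->; rewrite ltn_mod b_gt0. Qed.

Lemma digits_addMr b m d k i : m <= k ->
  digits b m (d * b ^ k + i) = digits b m i.
Proof.
elim: m => //= m IHm ltmk; rewrite IHm 1?ltnW //.
have [->|b_gt0] := posnP b; first by rewrite exp0n ?muln0 // (leq_ltn_trans _ ltmk).
(* As [m < k], the added term is a multiple of [b ^ m.+1]; divided by [b ^ m] it is still a multiple
   of [b], so the digit of rank [m] does not change. *)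
congr cons; rewrite -(subnK ltmk) addnS expnS expnD mulnCA !mulnA divnMDl; last first.
  by rewrite expn_gt0 b_gt0.
by rewrite -mulnA mulnC modnMDl.
Qed.

Lemma digits_surj b u : all (gtn b) u ->
  exists2 i, i < b ^ size u & digits b (size u) i = u.
Proof.
elim: u => [|d u IHu] /=; first by exists 0.
case/andP=> ltdb /IHu[i lti iE]; have b_gt0 := leq_ltn_trans (leq0n d) ltdb.
exists (d * b ^ size u + i).
  rewrite expnS -addnS (leq_trans (leq_add (leqnn _) lti)) // addnC -mulSn.
  by rewrite leq_mul2r ltdb orbT.
rewrite digits_addMr // iE divnMDl ?expn_gt0 ?b_gt0 // divn_small // addn0.
by rewrite modn_small.
Qed.

(* A table [t] assigns to every letter [d < K] and point [p < N] the point
   [table_move N t d p]; words act on points from the left. *)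
Definition table_move N t d p := t %/ N ^ (d * N + p) %% N.

Definition table_act N t u p := foldr (table_move N t) p u.

(** A table is a number in base [N] whose digit of rank [d * N + p] is the entry for [d] and [p];
    prescribed entries are realized by adding digits from the lowest rank upwards. *)
Lemma table_surj K N (f : nat -> nat -> nat) : 0 < N ->
    (forall d p, d < K -> p < N -> f d p < N) ->
  exists2 t, t < N ^ (K * N) &
    forall d p, d < K -> p < N -> table_move N t d p = f d p.
Proof.
move=> N_gt0 fN; pose g j := f (j %/ N) (j %% N).
have gN j : j < K * N -> g j < N.
  by move=> ltj; apply: fN; rewrite ?ltn_mod // ltn_divLR.
have [t ltt tP] : exists2 t, t < N ^ (K * N) &
    forall j, j < K * N -> t %/ N ^ j %% N = g j.
  elim: (K * N) gN => [|m IHm] gN; first by exists 0.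
  have [j ltj|t ltt tP] := IHm; first by apply: gN; apply: ltnW.
  exists (g m * N ^ m + t).
    rewrite expnS -addnS (leq_trans (leq_add (leqnn _) ltt)) // addnC -mulSn.
    by rewrite leq_mul2r gN ?orbT.
  move=> j; rewrite ltnS leq_eqVlt => /orP[/eqP->|ltj].
    by rewrite divnMDl ?expn_gt0 ?N_gt0 // divn_small // addn0 modn_small ?gN.
  rewrite -(tP j ltj) -(subnK ltj) addnS expnS expnD mulnCA !mulnA divnMDl.
    by rewrite -mulnA mulnC modnMDl.
  by rewrite expn_gt0 N_gt0.
exists t => // d p ltd ltp; rewrite /table_move tP.
  by rewrite /g divnMDl // divn_small // addn0 modnMDl modn_small.
by rewrite (leq_trans (n := d.+1 * N)) ?leq_mul2r ?ltd ?orbT // mulSn addnC ltn_add2r.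
Qed.

(** * Stabilizers of tables *)

(** The reduction modulo [K] keeps the letter 0, which stands for the identity, equal to its own
    inverse. *)
Definition inverse_word K u := rev [seq (K - d) %% K | d <- u].

(** Words of length exactly [N.*2] also account for shorter ones, padded by the letter 0. The
    indices decrease because primitive recursion pushes the word of each new index at the head of
    the coded list. *)
Definition stabilizer_words K N t :=
  [seq u <- [seq digits K N.*2 i | i <- rev (iota 0 (K ^ N.*2))]
     | table_act N t u 0 == 0].

(** Words of length [N.*2] suffice in the last test, since they generate the stabilizer of 0. Points
    outside the orbit of 0 are allowed, so that one [N] covers all indices up to [N]. *)
Definition regular_table K N t : bool :=
  [&& 0 < N,
      all (fun p => table_move N t 0 p == p) (iota 0 N),
      all (fun d => all (fun p =>
        table_move N t ((K - d) %% K) (table_move N t d p) == p) (iota 0 N))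
        (iota 0 K)
    & all (fun i => (table_act N t (digits K N.*2 i) 0 == 0) ==>
        all (fun p => table_act N t (digits K N.*2 i) p == p) (iota 0 N))
        (iota 0 (K ^ N.*2))].

Lemma all_iotaP b (P : pred nat) : reflect (forall i, i < b -> P i) (all P (iota 0 b)).
Proof.
apply: (iffP allP) => H i; last by rewrite mem_iota => /H.
by move=> lti; apply: H; rewrite mem_iota.
Qed.

Lemma mem_stabilizer_words K N t u :
    0 < K ->
  (u \in stabilizer_words K N t) =
    [&& size u == N.*2, all (gtn K) u & table_act N t u 0 == 0].
Proof.
move=> K_gt0; rewrite mem_filter andbA [RHS]andbC; congr andb.
apply/mapP/andP => [[i _ ->]|[/eqP su /digits_surj[i]]].
  by rewrite size_digits digits_lt.
by rewrite su => lti iE; exists i; rewrite ?iE // mem_rev mem_iota.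
Qed.

Lemma inverse_word_lt K u : 0 < K -> all (gtn K) (inverse_word K u).
Proof.
move=> K_gt0; rewrite all_rev all_map; apply/allP => d _ /=.
by rewrite ltn_mod.
Qed.

Section Stabilizer.
Local Open Scope classical_set_scope.
Local Open Scope nat_scope.
Variables (G : groupType) (K : nat) (lv : nat -> G).
Hypotheses (K_gt0 : 0 < K) (lv0 : lv 0 = 1%g)
  (lvV : forall d, d < K -> lv ((K - d) %% K) = (lv d)^-1%g)
  (lvG : forall g, exists2 u, all (gtn K) u & g = (\prod_(d <- u) lv d)%g).

Definition digits_val u : G := (\prod_(d <- u) lv d)%g.

Lemma digits_val_cat u v : digits_val (u ++ v) = (digits_val u * digits_val v)%g.
Proof. exact: big_cat. Qed.

Lemma digits_val_inverse u :
  all (gtn K) u -> digits_val (inverse_word K u) = (digits_val u)^-1%g.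
Proof.
elim: u => [|d u IHu] /=; first by rewrite /digits_val !big_nil invg1.
case/andP=> ltd /IHu IH; rewrite /inverse_word /= rev_cons -cats1 digits_val_cat.
by rewrite [digits_val (rev _)]IH /digits_val big_seq1 big_cons invgM lvV.
Qed.

Variables (N t : nat).
Hypothesis tP : regular_table K N t.
Let N_gt0 : 0 < N. Proof. by case/and4P: tP. Qed.
Notation act := (table_act N t).
Notation mv := (table_move N t).

Let mv_lt d p : mv d p < N. Proof. by rewrite ltn_mod. Qed.

Let act_cat u v p : act (u ++ v) p = act u (act v p). Proof. exact: foldr_cat. Qed.

Let act_lt u p : p < N -> act u p < N.
Proof. by case: u => //= d u _; apply: mv_lt. Qed.

Let actK u p : all (gtn K) u -> p < N -> act (inverse_word K u) (act u p) = p.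
Proof.
elim: u p => [//|d u IHu] p /= /andP[ltd /IHu IH] ltp.
rewrite /inverse_word /= rev_cons -cats1 act_cat /=.
case/and4P: tP => _ _ /all_iotaP/(_ _ ltd)/all_iotaP invd _.
by rewrite (eqP (invd _ (act_lt _ ltp))); apply: IH.
Qed.

Let pad m u := nseq (m - size u) 0 ++ u.

Let act_pad m u p : p < N -> act (pad m u) p = act u p.
Proof.
move=> ltp; rewrite act_cat; elim: (m - _) => //= k ->.
by case/and4P: tP => _ /all_iotaP/(_ _ (act_lt u ltp))/eqP.
Qed.

Let val_pad m u : digits_val (pad m u) = digits_val u.
Proof.
rewrite digits_val_cat; elim: (m - _) => [|k].
  by rewrite /digits_val big_nil mul1g.
by rewrite /digits_val /= big_cons lv0 mul1g.
Qed.

Let mem_pad u : all (gtn K) u -> size u <= N.*2 -> act u 0 = 0 ->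
  pad N.*2 u \in stabilizer_words K N t.
Proof.
move=> uK us u0; rewrite mem_stabilizer_words // act_pad // u0 eqxx andbT.
by rewrite size_cat size_nseq subnK // eqxx all_cat uK all_nseq /= K_gt0 orbT.
Qed.

(** The table is not asked to respect the relations of [G]: this is the image in [G] of the
    stabilizer of 0 in the free group on the letters. *)
Definition stabilizer : set G :=
  generated [seq digits_val u | u <- stabilizer_words K N t].

Let stab_short u : all (gtn K) u -> size u <= N.*2 -> act u 0 = 0 ->
  stabilizer (digits_val u).
Proof.
move=> uK us u0; rewrite -(val_pad N.*2); apply: mem_generated.
by apply: map_f; apply: mem_pad.
Qed.

(** By pigeonhole, two suffixes of a word of length at least [N] send 0 to the same point; deleting
    the letters between them shortens the word without changing the image of 0. *)
Let short_word u : all (gtn K) u ->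
  exists r, [/\ all (gtn K) r, size r < N & act r 0 = act u 0].
Proof.
have [m] := ubnP (size u); elim: m u => // m IHm u ltum uK.
have [ltuN|leNu] := ltnP (size u) N; first by exists u.
pose f (i : 'I_(size u).+1) : 'I_N := Ordinal (act_lt (drop i u) N_gt0).
have /injectivePn[i [j neij fij]] : ~~ injectiveb f.
  by apply/injectiveP => /leq_card; rewrite !card_ord leqNgt ltnS leNu.
wlog ltij : i j neij fij / i < j.
  move=> W; case: (ltngtP i j) => [|ltji|eqij]; first exact: W.
    by apply: (W j i) => //; rewrite eq_sym.
  by rewrite (val_inj eqij) eqxx in neij.
have [||r [rK rN rE]] := IHm (take i u ++ drop j u).
- rewrite size_cat size_drop size_take_min.
  have leju : j <= size u by rewrite -ltnS.
  rewrite (minn_idPl (leq_trans (ltnW ltij) leju)).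
  apply: (@leq_trans (size u)); last by rewrite -ltnS.
  by rewrite -[ltnRHS](subnKC leju) ltn_add2r.
- have := uK; rewrite -{1}[u](cat_take_drop i) all_cat => /andP[takeK _].
  have := uK; rewrite -{1}[u](cat_take_drop j) all_cat => /andP[_ dropK].
  by rewrite all_cat takeK.
exists r; split=> //; rewrite rE act_cat -[act (drop j u) 0]/(val (f j)) -fij.
by rewrite /= -act_cat cat_take_drop.
Qed.

(** Schreier's argument. For a word [d :: u], take a short [r'] sending 0 where [u] does. Then
    [inverse_word K r ++ d :: r'] fixes 0 and has length at most [N.*2], and the remaining factor is
    handled by induction on [u]. *)
Let stab_coset u r : all (gtn K) u -> all (gtn K) r -> size r < N ->
  act r 0 = act u 0 -> stabilizer ((digits_val r)^-1 * digits_val u)%g.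
Proof.
elim: u r => [|d u IHu] r /=.
  move=> _ rK rN r0; rewrite /(digits_val [::]) big_nil mulg1.
  apply: generatedV; apply: stab_short => //.
  by rewrite (leq_trans (ltnW rN)) // -addnn leq_addr.
case/andP=> ltd uK rK rN rE; have [r' [r'K r'N r'E]] := short_word uK.
have := generatedM (stab_short (u := inverse_word K r ++ d :: r') _ _ _)
  (IHu r' uK r'K r'N r'E).
rewrite digits_val_cat digits_val_inverse // /digits_val !big_cons.
rewrite -!mulgA mulVKg; apply.
- by rewrite all_cat inverse_word_lt //= ltd.
- rewrite size_cat size_rev size_map /= -addnn leq_add // ltnW //.
by rewrite act_cat /= r'E -rE actK.
Qed.

(** Regularity makes every generator act trivially at all points, a property inherited by products
    and inverses. *)
Let stab_fix g : stabilizer g -> exists2 u,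
  all (gtn K) u /\ (forall p, p < N -> act u p = p) & g = digits_val u.
Proof.
move: g; apply: generated_ind => [|x y [u [uK uid] ->] [v [vK vid] ->]||].
- by exists [::]; rewrite // /digits_val big_nil.
- exists (u ++ v); rewrite ?digits_val_cat // all_cat uK vK; split=> // p ltp.
  by rewrite act_cat vid ?uid.
- move=> x [u [uK uid] ->]; exists (inverse_word K u).
    by rewrite inverse_word_lt //; split=> // p ltp; rewrite -{1}(uid p) ?actK.
  by rewrite digits_val_inverse.
move=> x /mapP[u uL ->]; exists u => //; move: uL.
rewrite mem_stabilizer_words // => /and3P[/eqP su uK u0]; split=> // p ltp.
case/and4P: tP => _ _ _ /all_iotaP fixL; have [i lti iE] := digits_surj uK.
rewrite su in lti iE; have := fixL i lti; rewrite iE u0 => /all_iotaP.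
by move/(_ p ltp)/eqP.
Qed.

Let stabI u : all (gtn K) u -> act u 0 = 0 -> stabilizer (digits_val u).
Proof.
move=> uK u0; have := stab_coset (r := [::]) uK isT N_gt0 (esym u0).
by rewrite {1}/digits_val big_nil invg1 mul1g.
Qed.

(** A member is the value of a word acting trivially everywhere; any conjugate of that word fixes 0,
    hence has its value in the stabilizer. *)
Lemma stabilizer_normal : normal_set stabilizer.
Proof.
move=> _ g /stab_fix[v [vK vid] ->]; have [u uK gE] := lvG g.
have {gE} -> : g = digits_val u by [].
rewrite conjgE -digits_val_inverse // -!digits_val_cat; apply: stabI.
  by rewrite !all_cat inverse_word_lt // uK vK.
by rewrite !act_cat vid ?actK // act_lt.
Qed.

Lemma stabilizer_cosets : exists rep : 'I_N -> G,
  forall g, exists i, stabilizer ((rep i)^-1 * g)%g.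
Proof.
have /choice[rep repP] (i : 'I_N) : exists x, forall u, all (gtn K) u ->
    act u 0 = i -> stabilizer (x^-1 * digits_val u)%g.
  have [[u [uK ui]]|noi] := pselect (exists u, all (gtn K) u /\ act u 0 = i).
    have [r [rK rN rE]] := short_word uK.
    by exists (digits_val r) => v vK vi; apply: stab_coset; rewrite // rE ui.
  (* A point outside the orbit of 0 corresponds to no coset and gets a dummy representative. *)
  by exists 1%g => u uK ui; case: noi; exists u.
exists rep => g; have [u uK ->] := lvG g.
by exists (Ordinal (act_lt u N_gt0)); apply: repP.
Qed.

Lemma stabilizer_finite_index : finite_index stabilizer.
Proof.
have [rep repP] := stabilizer_cosets.
apply: (@sub_finite_set _ _
  (range (fun i : 'I_N => [set (rep i * h)%g | h in stabilizer]))); last first.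
  exact/finite_image/finite_finset.
move=> _ [g _ <-]; have [i Hi] := repP g; exists i => //.
apply/seteqP; split=> _ [h Hh <-].
  exists (g^-1 * rep i * h)%g; last by rewrite -mulgA mulVKg.
  apply: generatedM Hh; have := generatedV Hi.
  by rewrite invgM invgK.
exists ((rep i)^-1 * g * h)%g; last by rewrite -mulgA mulVKg.
exact: generatedM Hi Hh.
Qed.

Lemma stabilizer_detected g : ~ stabilizer g ->
  exists Q : finGroupType, detected_by g Q /\ #|Q| <= N.
Proof.
have [rep repP] := stabilizer_cosets.
have [Q [phi [phi_surj phiP leQ]]] := finite_quotient
  (@generatedM _ _) (@generatedV _ _) stabilizer_normal repP.
by move=> Hg; exists Q; split=> //; exists phi; split=> // /phiP.
Qed.

End Stabilizer.

(** The table is the action of [Q] on itself by left multiplication through [phi]. A word fixing the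
    point of the identity lies in the kernel, so it acts trivially; hence the table is regular and
    its stabilizer is contained in the kernel, which avoids [g]. *)
Lemma detected_stabilizer (G : groupType) K (lv : nat -> G) N g
    (Q : finGroupType) :
    0 < K -> lv 0 = 1%g -> (forall d, d < K -> lv ((K - d) %% K) = (lv d)^-1%g) ->
    0 < N -> detected_by g Q -> #|Q| <= N ->
  exists2 t, t < N ^ (K * N) & regular_table K N t /\ ~ stabilizer K lv N t g.
Proof.
move=> K_gt0 lv0 lvV N_gt0 [phi [_ phig]] leQN.
have phi1 : phi 1%g = 1%g by apply: (mulgI (phi 1%g)); rewrite -gmulfM !mulg1.
have phiV x : phi x^-1%g = (phi x)^-1%g.
  by apply: (mulgI (phi x)); rewrite -gmulfM !mulgV.
(* The identity comes first, so that it is numbered 0, the base point of stabilizers. *)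
pose s : seq Q := 1%g :: rem 1%g (enum Q).
have ps : perm_eq s (enum Q) by rewrite perm_sym perm_to_rem // mem_enum.
have ss : size s = #|Q| by rewrite (perm_size ps) cardE.
have us : uniq s by rewrite (perm_uniq ps) enum_uniq.
have sx x : x \in s by rewrite (perm_mem ps) mem_enum.
pose q p := nth 1%g s p; pose idx x := index x s.
have qK p : p < #|Q| -> idx (q p) = p by rewrite -ss => ltp; apply: index_uniq.
have idxK x : q (idx x) = x by apply: nth_index.
have idx_lt x : idx x < #|Q| by rewrite -ss index_mem.
(* The points from [#|Q|] to [N - 1] are surplus and every letter fixes them. *)
pose f d p := if p < #|Q| then idx (phi (lv d) * q p)%g else p.
have fN d p : d < K -> p < N -> f d p < N.
  by move=> _ ltp; rewrite /f; case: ifP => // _; apply: leq_trans leQN.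
have [t ltt tE] := table_surj N_gt0 fN.
have fE d p : d < K -> p < N -> table_move N t d p = f d p by apply: tE.
have actE u p : all (gtn K) u -> p < N -> table_act N t u p =
    if p < #|Q| then idx (phi (digits_val lv u) * q p)%g else p.
  move=> + ltp; elim: u => [|d u IHu] /=.
    by rewrite /digits_val big_nil phi1 mul1g; case: ifP => // /qK.
  case/andP=> ltd uK; rewrite {}IHu // fE //; last first.
    by case: ifP => // _; apply: leq_trans leQN.
  rewrite /f /digits_val big_cons gmulfM -mulgA.
  by case: (ltnP p #|Q|) => [_|]; [rewrite idx_lt idxK | rewrite leqNgt => /negbTE->].
have act0 u : all (gtn K) u -> table_act N t u 0 = 0 -> phi (digits_val lv u) = 1%g.
  move=> uK; rewrite actE // (leq_trans _ (idx_lt 1%g)) // /q mulg1.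
  by move/(congr1 q); rewrite idxK.
exists t => //; split.
  apply/and4P; split=> //.
  - apply/all_iotaP => p ltp; rewrite fE // /f lv0 phi1 mul1g.
    by case: ifP => // /qK->.
  - apply/all_iotaP => d ltd; apply/all_iotaP => p ltp.
    rewrite !fE ?ltn_mod // ?fN // /f lvV // phiV.
    case: (ltnP p #|Q|) => [ltpQ|]; last by rewrite leqNgt => /negbTE->.
    by rewrite idx_lt idxK mulKg qK.
  apply/all_iotaP => i _; apply/implyP => /eqP/(act0 _ (digits_lt _ _ K_gt0)) i0.
  apply/all_iotaP => p ltp; rewrite actE ?digits_lt // i0 mul1g.
  by case: ifP => // /qK->.
suff kerS : stabilizer K lv N t g -> phi g = 1%g by move/kerS.
apply: (generated_ind (A := fun g => phi g = 1%g)) => [|x y x1 y1|x x1|].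
- exact: phi1.
- by rewrite gmulfM x1 y1 mulg1.
- by rewrite phiV x1 invg1.
move=> _ /mapP[u uL ->]; move: uL.
by rewrite mem_stabilizer_words // => /and3P[_ uK /eqP/(act0 _ uK)].
Qed.

(** * Programs for words and tables *)

Ltac recursive_solve :=
  repeat match goal with
  | |- recursive _ (fun r => r _) => by apply: recursive_var
  | |- recursive _ (fun=> ?c) => exact: recursive_const
  | |- _ => recursive_hyp
  | |- recursive _ (fun r => (@?a r).+1) => apply: recursive_succ
  | |- recursive _ (fun r => (@?a r).-1) => apply: recursive_pred
  | |- recursive _ (fun r => (@?a r).*2) => apply: recursive_double
  | |- recursive _ (fun r => @?a r + @?b r) => apply: recursive_add
  | |- recursive _ (fun r => @?a r - @?b r) => apply: recursive_sub
  | |- recursive _ (fun r => @?a r * @?b r) => apply: recursive_mul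
  | |- recursive _ (fun r => @?a r ^ @?b r) => apply: recursive_exp
  | |- recursive _ (fun r => @?a r %/ @?b r) => apply: recursive_div
  | |- recursive _ (fun r => @?a r %% @?b r) => apply: recursive_mod
  | |- recursive _ (fun r => nat_of_bool (@?a r && @?b r)) => apply: recursive_and
  | |- recursive _ (fun r => nat_of_bool (@?a r || @?b r)) => apply: recursive_or
  | |- recursive _ (fun r => nat_of_bool (~~ @?a r)) => apply: recursive_neg
  | |- recursive _ (fun r => nat_of_bool (@?a r ==> @?b r)) => apply: recursive_imp
  | |- recursive _ (fun r => nat_of_bool (@?a r == @?b r)) => apply: recursive_eq
  | |- recursive _ (fun r => nat_of_bool (@?a r <= @?b r)) => apply: recursive_leq
  | |- recursive _ (fun r => nat_of_bool (all _ (iota 0 (@?b r)))) =>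
      apply: recursive_all
  | |- recursive _ (fun r => nat_of_bool (has _ (iota 0 (@?b r)))) =>
      apply: recursive_has
  end.

(** Words act from the left, so the last letter, which is the least significant digit, acts first:
    the loop reads the digits by increasing rank. *)
Lemma recursive_act K n N t m i p :
    recursive n N -> recursive n t -> recursive n m -> recursive n i ->
    recursive n p ->
  recursive n (fun r => table_act (N r) (t r) (digits K (m r) (i r)) (p r)).
Proof.
move=> NR tR mR iR pR; apply: recursive_ext (recursive_rec
  (s := fun j h r => table_move (N r) (t r) (i r %/ K ^ j %% K) h)
  pR mR _) => [r|]; first by elim: (m r) => //= j ->.
by rewrite /table_move; recursive_solve.
Qed.

Lemma recursive_regular_table K n N t :
  recursive n N -> recursive n t ->
  recursive n (fun r => regular_table K (N r) (t r)).
Proof.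
move=> NR tR; rewrite /regular_table /table_move; recursive_solve.
all: apply: recursive_act; recursive_solve.
Qed.

(** [T] is a dictionary: its entry [d] lists the letter codes of a word, over the generating list of
    a given algorithm, that represents the letter [d]. *)
Definition code_word (T : seq (seq nat)) u :=
  CodeSeq.code (flatten [seq nth [::] T d | d <- u]).

(** [T] is a constant of the program, so the lookup is a finite case distinction. The fold pushes an
    entry in front of the list coded by [c r], following the recursion that defines
    [CodeSeq.code]. *)
Lemma recursive_lookup T n d c :
    recursive n d -> recursive n c ->
  recursive n (fun r =>
    foldr (fun a m => 2 ^ a * m.*2.+1) (c r) (nth [::] T (d r))).
Proof.
elim: T d => [|s T IHT] d dR cR.
  by apply: recursive_ext cR => r; rewrite nth_nil.
have sR : recursive n (fun r => foldr (fun a m => 2 ^ a * m.*2.+1) (c r) s).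
  by elim: s => [|a s IHs] //=; recursive_solve.
have TR := IHT _ (recursive_pred dR) cR.
apply: recursive_ext (recursive_if (recursive_eq dR (recursive_const n 0)) sR TR).
by move=> r; case: (d r).
Qed.

Lemma recursive_code_word K T n m i :
    recursive n m -> recursive n i ->
  recursive n (fun r => code_word T (digits K (m r) (i r))).
Proof.
move=> mR iR; apply: recursive_ext (recursive_rec
  (s := fun j h r => foldr (fun a k => 2 ^ a * k.*2.+1) h
    (nth [::] T (i r %/ K ^ j %% K))) (recursive_const n 0) mR _) => [r|].
  by elim: (m r) => //= j ->; rewrite /code_word /= /CodeSeq.code foldr_cat.
by apply: recursive_lookup; recursive_solve.
Qed.

Lemma recursive_code_stabilizer K T n N t :
    recursive n N -> recursive n t ->
  recursive n (fun r =>
    CodeSeq.code [seq code_word T u | u <- stabilizer_words K (N r) (t r)]).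
Proof.
move=> NR tR; apply: recursive_ext (recursive_rec (s := fun i h r =>
    if table_act (N r) (t r) (digits K (N r).*2 i) 0 == 0 then
      2 ^ code_word T (digits K (N r).*2 i) * h.*2.+1 else h)
  (recursive_const n 0) (recursive_exp (recursive_const n K)
  (recursive_double NR)) _) => [r|].
  rewrite /stabilizer_words; elim: (K ^ _) => // i IHi.
  by rewrite -[in RHS](addn1 i) iotaD rev_cat add0n /= IHi; case: ifP.
apply: recursive_if; recursive_solve.
  by apply: recursive_act; recursive_solve.
by apply: recursive_code_word; recursive_solve.
Qed.

(** * Detection of balls *)

Lemma word_val_surj (G : groupType) (S : seq G) :
  generates S -> forall g, exists w : word S, word_val w = g.
Proof.
move=> SG g; have [m [s [_ sS ->]]] : generated S g by rewrite SG.
elim: s sS => [|x s IHs] sS; first by exists [::]; rewrite /word_val !big_nil.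
have [|w wE] := IHs; first by move=> y ys; apply: sS; rewrite inE ys orbT.
have [l lE] : exists l : bool * 'I_(size S), letter_val l = x.
  case/orP: (sS x (mem_head _ _)) => /(tnthP (in_tuple S))[i xE].
    by exists (false, i); rewrite /letter_val /= -xE.
  by exists (true, i); rewrite /letter_val /= -xE invgK.
by exists (l :: w); rewrite /word_val !big_cons lE -wE.
Qed.

(** Words for the letters are picked by choice; only [K] of them are needed, so they form a finite
    dictionary that a program can contain. *)
Lemma word_translation (G : groupType) (S : seq G) K (lv : nat -> G) :
  generates S -> exists T, forall u, all (gtn K) u ->
  exists w : word S, word_val w = digits_val lv u /\ word_code w = code_word T u.
Proof.
move=> /word_val_surj/choice[wd wdP].
pose cl (l : bool * 'I_(size S)) := l.1 + l.2.*2.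
exists [seq map cl (wd (lv d)) | d <- iota 0 K] => u uK.
exists (flatten [seq wd (lv d) | d <- u]); split.
  elim: u {uK} => [|d u IHu]; first by rewrite /word_val /digits_val !big_nil.
  rewrite /= /word_val big_cat /= [X in (_ * X)%g]IHu [X in (X * _)%g]wdP.
  by rewrite /digits_val big_cons.
rewrite /word_code /code_word map_flatten -map_comp; congr (CodeSeq.code (flatten _)).
apply/eq_in_map => d /(allP uK) /= ltd.
by rewrite (nth_map 0) ?size_iota // nth_iota.
Qed.

(** * Letters and balls *)

Section Letters.
Variables (G : groupType) (X : seq G).
Local Notation K := (size X).*2.+1.

(** The inverses are listed backwards so that the inverse of the letter [d] sits at [K - d]. *)
Definition letter d : G := nth 1%g (1%g :: X ++ rev [seq x^-1%g | x <- X]) d.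

Let letter_low d : d < size X -> letter d.+1 = nth 1%g X d.
Proof. by move=> ltd; rewrite /letter /= nth_cat ltd. Qed.

Let letter_high d : d < size X -> letter ((size X).*2 - d) = (nth 1%g X d)^-1%g.
Proof.
move=> ltd; have -> : (size X).*2 - d = (size X + (size X - d.+1)).+1.
  by rewrite -addnn -addnBA 1?ltnW // -addnS subnSK.
rewrite /letter /= nth_cat ltnNge leq_addr addKn /=.
rewrite nth_rev size_map ?ltn_subrL ?(leq_trans _ ltd) // subnSK // subKn 1?ltnW //.
by rewrite (nth_map 1%g).
Qed.

Lemma letterV d : d < K -> letter ((K - d) %% K) = (letter d)^-1%g.
Proof.
case: d => [|d]; first by rewrite subn0 modnn /letter /= invg1.
rewrite ltnS => ltd; rewrite subSS modn_small ?ltnS ?leq_subr //.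
have [ltdX|leXd] := ltnP d (size X); first by rewrite letter_high ?letter_low.
pose e := (size X).*2 - d.+1.
have lte : e < size X.
  by rewrite /e -(ltn_add2r d.+1) subnK // -addnn ltn_add2l ltnS.
have dE : d.+1 = (size X).*2 - e by rewrite /e subKn.
have -> : (size X).*2 - d = e.+1 by rewrite /e subnSK.
by rewrite dE letter_high // letter_low // invgK.
Qed.

Lemma letter_gen d : 0 < d < K -> (letter d \in X) || ((letter d)^-1%g \in X).
Proof.
case: d => // d /andP[_ ltK]; have ltd : d < (size X).*2 by [].
have [ltdX|leXd] := ltnP d (size X).
  by rewrite letter_low // mem_nth.
rewrite -letterV //.
rewrite subSS modn_small ?ltnS ?leq_subr // -subnSK //.
have lte : (size X).*2 - d.+1 < size X.
  by rewrite -(ltn_add2r d.+1) subnK // -addnn ltn_add2l ltnS.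
by rewrite (letter_low lte) mem_nth ?orbT.
Qed.

(** The identity letter 0 pads products of fewer than [n] generators to length exactly [n];
    conversely zeros are dropped. *)
Lemma ball_digits n g : length_le X n g <->
  exists u, [/\ all (gtn K) u, size u = n & g = digits_val letter u].
Proof.
split=> [[s [+ sX ->]]|[u [+ <- ->]]] {g}.
  have [u [uK su ->]] : exists u, [/\ all (gtn K) u, size u = size s &
      (\prod_(x <- s) x)%g = digits_val letter u].
    elim: s sX => [|x s IHs] sX; first by exists [::]; rewrite /digits_val !big_nil.
    have [|u [uK su uE]] := IHs; first by move=> y ys; apply: sX; rewrite inE ys orbT.
    suff [d ltd dE] : exists2 d, d < K & letter d = x.
      exists (d :: u); split=> /=; rewrite ?su //; first by rewrite ltd.
      by rewrite /digits_val !big_cons dE uE.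
    case/orP: (sX x (mem_head _ _)) => /(nthP 1%g)[i lti iE].
      exists i.+1; last by rewrite letter_low.
      by rewrite ltnS (leq_trans lti) // -addnn leq_addr.
    exists ((size X).*2 - i); first by rewrite ltnS leq_subr.
    by rewrite letter_high // iE invgK.
  rewrite -su => leun; exists (nseq (n - size u) 0 ++ u); split.
  - by rewrite all_cat uK all_nseq orbT.
  - by rewrite size_cat size_nseq subnK.
  rewrite digits_val_cat; elim: (n - _) => [|m].
    by rewrite {2}/digits_val big_nil mul1g.
  move=> {1}->; congr (_ * _)%g.
  by rewrite /digits_val /= big_cons {2}/letter /= mul1g.
elim: u => [_|d u IHu /= /andP[ltd /IHu[s [su sX uE]]]].
  by exists [::]; rewrite /digits_val !big_nil.
case: d ltd => [|d] ltd.
  exists s; split=> //; first exact: leqW.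
  by rewrite /digits_val big_cons {1}/letter /= mul1g -uE.
exists (letter d.+1 :: s); split=> //=.
  by move=> x; rewrite inE => /orP[/eqP->|/sX//]; apply: letter_gen.
by rewrite /digits_val !big_cons -uE.
Qed.

End Letters.

(** * Decidability of detection *)

Section Growth.
Variables (G : groupType) (X : seq G).
Hypothesis XG : generates X.
Local Notation K := (size X).*2.+1.
Local Notation lv := (letter X).

Let lvG g : exists2 u, all (gtn K) u & g = digits_val lv u.
Proof.
have [n /ball_digits[u [uK _ ->]]] : generated X g by rewrite XG.
by exists u.
Qed.

(** A table has [K * N] entries below [N], whence the bound on [t]. *)
Definition detects_digits n N : bool :=
  all (fun i => (digits_val lv (digits K n i) == 1%g) ||
      has (fun t => regular_table K N t &&
          ~~ `[< stabilizer K lv N t (digits_val lv (digits K n i)) >])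
        (iota 0 (N ^ (K * N))))
    (iota 0 (K ^ n)).

Lemma detects_digitsP n N : 0 < N -> reflect (detects_ball X n N) (detects_digits n N).
Proof.
move=> N_gt0.
apply: (iffP (all_iotaP _ _)) => [dN _ /ball_digits[u [uK su ->]]|dN i _].
  have [i + iE] := digits_surj uK; rewrite su in iE * => /dN; rewrite iE.
  case/orP=> [/eqP//|/hasP[t _ /andP[tP /asboolPn Hu]]] _.
  by apply: stabilizer_detected Hu => //; apply: letterV.
apply/orP; have [|/eqP u1] := boolP (_ == 1%g); [by left | right].
have [|Q [Qu leQ]] := dN _ _ u1.
  by apply/ball_digits; exists (digits K n i); rewrite digits_lt ?size_digits.
have [|||t ltt [tP tu]] := detected_stabilizer (K := K) (lv := lv) _ _ _ N_gt0 Qu leQ.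
- by [].
- by [].
- exact: letterV.
by apply/hasP; exists t; rewrite ?mem_iota // tP; apply/asboolPn.
Qed.

Hypothesis hmem : finite_index_normal_membership_solvable G.
Hypothesis hwp : word_problem_solvable G.

Let recursive_trivial k n i : recursive k n -> recursive k i ->
  recursive k (fun r => digits_val lv (digits K (n r) (i r)) == 1%g).
Proof.
have [S [SG [f fP]]] := hwp; have [T TP] := word_translation K lv SG.
move=> nR iR; apply: (recursive_oracle (f := f)) (recursive_code_word K T nR iR) => r.
by have [|w [<- <-]] := TP (digits K (n r) (i r)); rewrite ?digits_lt.
Qed.

(** Regularity of the table is the guard: it makes the stabilizer normal of finite index, which is
    the promise under which the membership program halts with the right answer. *)
Let recursive_member k N t n i :
    recursive k N -> recursive k t -> recursive k n -> recursive k i ->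
  recursive k (fun r => if 0 < regular_table K (N r) (t r) then
    `[< stabilizer K lv (N r) (t r) (digits_val lv (digits K (n r) (i r))) >] : nat
    else 0).
Proof.
have [S [SG [f fP]]] := hmem; have [T TP] := word_translation K lv SG.
(* The bound on the letters moves under the existential so that a choice function exists on all
   words; those with other letters get the empty word. *)
have {}TP u : exists w : word S, all (gtn K) u ->
    word_val w = digits_val lv u /\ word_code w = code_word T u.
  by have [/TP[w wE]|_] := boolP (all (gtn K) u); [exists w | exists [::]].
have /choice[wd wdP] := TP.
move=> NR tR nR iR; apply: (recursive_guarded_oracle (f := f)
  (recursive_code_word K T nR iR) (recursive_code_stabilizer K T NR tR)
  (recursive_regular_table K NR tR)) => r.
rewrite lt0b => tP; pose L := map wd (stabilizer_words K (N r) (t r)).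
have [|<- <-] := wdP (digits K (n r) (i r)); first by rewrite digits_lt.
have LK u : u \in stabilizer_words K (N r) (t r) -> all (gtn K) u.
  by rewrite mem_stabilizer_words // => /and3P[].
have -> : CodeSeq.code [seq code_word T u | u <- stabilizer_words K (N r) (t r)]
    = words_code L.
  rewrite /words_code -map_comp; congr CodeSeq.code; apply/eq_in_map => u /LK uK.
  by have [_ /= ->] := wdP u uK.
have HE : stabilizer K lv (N r) (t r) = generated [seq word_val w | w <- L].
  rewrite -map_comp; congr generated; apply/eq_in_map => u /LK uK.
  by have [/= -> _] := wdP u uK.
rewrite HE; apply: fP; rewrite -HE.
  by apply: stabilizer_finite_index => //; apply: letterV.
by apply: stabilizer_normal => //; apply: letterV.
Qed.

Lemma recursive_detects_digits k n N :
  recursive k n -> recursive k N -> recursive k (fun r => detects_digits (n r) (N r)).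
Proof.
move=> nR NR; rewrite /detects_digits; apply: recursive_all; first by recursive_solve.
apply: recursive_or; first by apply: recursive_trivial; recursive_solve.
apply: recursive_has; first by recursive_solve.
(* Both factors of a conjunction are evaluated, so the membership test must carry its own guard; its
   value 0 on other tables is harmless, as the conjunction is false there anyway. *)
pose g (r : nat -> nat) := if 0 < regular_table K (N (fun j => r j.+2)) (r 0) then
  `[< stabilizer K lv (N (fun j => r j.+2)) (r 0)
     (digits_val lv (digits K (n (fun j => r j.+2)) (r 1))) >] : nat else 0.
have gR : recursive k.+2 (fun r => g r == 0).
  apply: recursive_eq; last exact: recursive_const.
  by apply: recursive_member; recursive_solve.
have tR : recursive k.+2 (fun r => regular_table K (N (fun j => r j.+2)) (r 0)).
  by apply: recursive_regular_table; recursive_solve.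
apply: recursive_ext (recursive_and tR gR) => r /=.
by rewrite /g lt0b; case: ifP => //= _; case: (asbool _).
Qed.

End Growth.

Theorem theorem2 (G : groupType)
  (hfg : finitely_generated G) (hrf : residually_finite G)
  (hmem : finite_index_normal_membership_solvable G)
  (hwp : word_problem_solvable G) :
  forall X : seq G, generates X -> computable (rf_growth X).
Proof.
move=> X XG.
(* Variable 0 is the search variable and variable 1 is the radius. The bound tested is the successor
   of the search variable because growth values are positive; the successor is applied again to the
   result of the search. *)
have gR : recursive 2 (fun r => ~~ detects_digits X (r 1) (r 0).+1).
  by apply: recursive_neg; apply: recursive_detects_digits => //; recursive_solve.
have [f fP] := recursive_min gR.
exists (Rcomp Rsucc (fun=> f)) => n /=; have [] := rf_growthP X n hrf.
case: (rf_growth X n) => [[|N] //= N_gt0] dN minN.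
exists [tuple of [:: N]]; split=> // i; rewrite ord1; apply: fP => [|j ltjN] /=.
  by rewrite (introT (detects_digitsP _ _ _) dN).
rewrite lt0b; apply/(detects_digitsP XG) => // dj.
by have /= := minN (exist _ j.+1 isT) dj; rewrite ltnS leqNgt ltjN.
Qed.
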